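(* Let $(Y,d)$ be a complete and separable metric space. Then $(Q(Y),MH)$ is a complete metric space.
   Context: $Q(Y)$ is the collection of all Borel probability measures on $Y$. Let $\mathrm{Lip}_1(Y)=\{f:Y\to\mathbb{R} : |f(x)-f(y)|\le d(x,y)\text{ for all }x,y\in Y\}$. The modified Kantorovich metric $MH$ on $Q(Y)$ is $$MH(\mu,\nu)=\sup\left\{\left|\int_Y f\,d\mu-\int_Y f\,d\nu\right| : f\in\mathrm{Lip}_1(Y)\text{ and }\|f\|_\infty\le 1\right\}.$$ *)

(* Defs.v *)
From HB Require Import structures.
From mathcomp Require Import all_boot all_order all_algebra.
From mathcomp Require Import all_classical all_reals all_analysis.

Set Implicit Arguments.
Unset Strict Implicit.
Unset Printing Implicit Defensive.

Import Order.TTheory GRing.Theory Num.Theory.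
Import numFieldNormedType.Exports.

Local Open Scope classical_set_scope.
Local Open Scope ring_scope.

(* As for the library's [completeType] and [measurableType], such a space has
   a distinguished point, hence is nonempty. *)
#[short(type="completeMetricType")]
HB.structure Definition CompleteMetric (K : numDomainType) :=
  {T of Complete T & Metric K T}.

(* [axioms_] is the HB class record: [M] ranges over the complete metric
   structures with carrier [T]; the distance determines the balls, hence the
   uniformity in which Cauchy filters are required to converge. *)
Definition is_complete_metric (R : realType) (T : Type) (d : T -> T -> R) :
    Prop :=
  exists M : CompleteMetric.axioms_ R T, @mdist R (CompleteMetric.Pack M) = d.

Definition separable (T : topologicalType) : Prop :=
  exists2 S : set T, countable S & dense S.

Definition borel (R : realType) (Y : completeMetricType R) :=
  g_sigma_algebraType (@open Y).

(* A [probability] is a function on all subsets, unconstrained outside the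
   sigma-algebra; a measure on the Borel sets is represented by its unique
   extension that vanishes on the non-Borel sets, so that [=] on [Q Y] is
   equality on Borel sets. *)
Record Q (R : realType) (Y : completeMetricType R) := BorelProbability {
  Qmeasure :> probability (borel Y) R ;
  Qmeasure_out :
    forall A : set (borel Y), ~ measurable A -> Qmeasure A = 0%E }.

Definition Lip1 (R : realType) (Y : completeMetricType R) : set (Y -> R) :=
  [set f | forall x y, `|f x - f y| <= mdist x y].
Arguments Lip1 {R} Y _.

Definition supnorm (R : realType) (T : Type) (f : T -> R) : \bar R :=
  ereal_sup (range (fun x => `|f x|%:E)).

Definition MH (R : realType) (Y : completeMetricType R) (mu nu : Q Y) : R :=
  sup [set `|(\int[mu]_y f y) - (\int[nu]_y f y)|
      | f in Lip1 Y `&` [set f | (supnorm f <= 1)%E]].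

(* Main.v *)
Require Import Defs.
From HB Require Import structures.
From mathcomp Require Import all_boot all_order all_algebra.
From mathcomp Require Import all_classical all_reals all_analysis.
From mathcomp Require Import lra.

Set Implicit Arguments.
Unset Strict Implicit.
Unset Printing Implicit Defensive.

Import Order.TTheory GRing.Theory Num.Theory.
Import numFieldNormedType.Exports.

Local Open Scope classical_set_scope.
Local Open Scope ring_scope.

(** The distance [MH] compares measures through bounded Lipschitz functions:
    if [f] is [k]-Lipschitz and bounded by [k], its integrals against [mu] and
    [nu] differ by at most [k * MH mu nu] (lemma [MH_BLball]).  The metric
    axioms follow at once, apart from separation, which holds because the
    indicator of an open set is an increasing limit of bounded Lipschitz
    functions and the open sets form a pi-system generating the Borel sets
    ([BL_separates_Q]).

    For completeness, let [F] be a Cauchy filter on [Q Y].  For every bounded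
    Lipschitz [f] the integrals of [f] converge along [F], uniformly over each
    ball of such functions, to a number [L f].  The functional [L] is linear,
    positive and sends 1 to 1, and the point is to show that it is integration
    against some [mu] in [Q Y]; uniformity then turns the convergence of
    integrals into convergence of [F] to [mu] for [MH].

    A positive functional need not be an integral.  What saves it is tightness:
    by separability each single [nu] in [Q Y] puts almost all of its mass in
    finitely many balls of a given radius ([separable_tight]), and [L], being
    close to such a [nu] on a single bump function, inherits this
    ([limit_mean_tight]).  In a complete space tightness yields the Daniell
    property: if bounded Lipschitz functions decrease pointwise to 0 then so do
    their values under [L] ([mean_daniell]).  Otherwise there would be points
    at which these functions stay large while lying in a totally bounded set;
    such points accumulate somewhere, and there the functions do not tend to 0.

    The measure is Caratheodory's: the mass of [A] is the infimum of the [c]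
    such that some increasing sequence of nonnegative bounded Lipschitz
    functions eventually reaches 1 at each point of [A] while its values under
    [L] are at most [c].  Increasing sequences, rather than series, make
    countable subadditivity ([covers_bigcup]) and the splitting of a set by an
    open set ([mass_open_split]) short computations.  The Daniell property is
    used exactly once, to see that the whole space does not get mass less than
    1 ([massT]).  Finally [L] is integration against this measure
    ([mean_Rintegral]): slicing [f] at integer heights gives
    [\int f <= L f + 1], scaling [f] removes the error term, and exchanging
    [f] with [- f] gives equality. *)

(** * Bounded Lipschitz functions *)

Section bounded_lipschitz.
Context {R : realType} {Y : metricType R}.
Implicit Types (f g : Y -> R) (k c : R) (A : set Y) (x : Y).

(** A single constant bounds both the values and the slopes, so that dividing by
    it lands in the class of functions defining [MH]. *)
Definition BLball k : set (Y -> R) := [set f |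
  (forall x, `|f x| <= k) /\ (forall x y, `|f x - f y| <= k * mdist x y)].

Definition BL : set (Y -> R) := \bigcup_k BLball k.

Lemma BLball_ge0 (x : Y) k f : BLball k f -> 0 <= k.
Proof. by case=> fk _; exact: le_trans (normr_ge0 _) (fk x). Qed.

Lemma BLballW k l f : k <= l -> BLball k f -> BLball l f.
Proof.
move=> kl [fk lf]; split=> [x|x y]; first exact: le_trans (fk x) kl.
by apply: le_trans (lf x y) _; rewrite ler_wpM2r// mdist_ge0.
Qed.

Lemma BLballM k l f : 0 <= l -> BLball k f -> BLball (l * k) (fun x => l * f x).
Proof.
move=> l0 [fk lf]; split=> [x|x y].
  by rewrite normrM ger0_norm// ler_wpM2l.
by rewrite -mulrBr normrM ger0_norm// -mulrA ler_wpM2l.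
Qed.

Lemma BL_cst c : BL (fun=> c).
Proof.
exists `|c| => //; split=> [x//|x y].
by rewrite subrr normr0 mulr_ge0// mdist_ge0.
Qed.

Lemma BLN f : BL f -> BL (fun x => - f x).
Proof.
move=> [k _ [fk lf]]; exists k => //; split=> [x|x y]; first by rewrite normrN.
by rewrite -opprD normrN.
Qed.

Lemma BLD f g : BL f -> BL g -> BL (fun x => f x + g x).
Proof.
move=> [k _ [fk lf]] [l _ [gl lg]]; exists (k + l) => //; split=> [x|x y].
  by rewrite (le_trans (ler_normD _ _))// lerD.
by rewrite opprD addrACA mulrDl (le_trans (ler_normD _ _))// lerD.
Qed.

Lemma BLB f g : BL f -> BL g -> BL (fun x => f x - g x).
Proof. by move=> bf bg; apply: BLD => //; exact: BLN. Qed.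

Lemma BLZ c f : BL f -> BL (fun x => c * f x).
Proof.
move=> [k _ [fk lf]]; exists (`|c| * k) => //; split=> [x|x y].
  by rewrite normrM ler_wpM2l.
by rewrite -mulrBr normrM -mulrA ler_wpM2l.
Qed.

Lemma BL_sum n (F : nat -> Y -> R) : (forall i, BL (F i)) ->
  BL (fun x => \sum_(i < n) F i x).
Proof.
move=> bF; elim: n => [|n ih].
  by under eq_fun do rewrite big_ord0; exact: BL_cst.
by under eq_fun do rewrite big_ord_recr; exact: BLD.
Qed.

Lemma BL_abs f : BL f -> BL (fun x => `|f x|).
Proof.
move=> [k _ [fk lf]]; exists k => //; split=> [x|x y].
  by rewrite normr_id.
exact: le_trans (ler_dist_dist _ _) (lf x y).
Qed.

Lemma BL_max f g : BL f -> BL g -> BL (fun x => Num.max (f x) (g x)).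
Proof.
move=> bf bg; under eq_fun do rewrite maxr_absE mulrC.
by apply: BLZ; apply: BLD; [exact: BLD|exact/BL_abs/BLB].
Qed.

Lemma BL_min f g : BL f -> BL g -> BL (fun x => Num.min (f x) (g x)).
Proof.
move=> bf bg; under eq_fun do rewrite minr_absE mulrC.
by apply: BLZ; apply: BLB; [exact: BLD|exact/BL_abs/BLB].
Qed.

Lemma BL_continuous f : BL f -> continuous f.
Proof.
move=> [k _ kf] x; have k0 := BLball_ge0 x kf.
apply/cvgrPdist_lt => e e0; have k1 : 0 < k + 1 by lra.
near=> y; apply: le_lt_trans (kf.2 x y) _.
have : mdist x y < e / (k + 1).
  have : ball x (e / (k + 1)) y.
    by near: y; apply: nbhsx_ballx; rewrite divr_gt0.
  by rewrite ballEmdist.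
rewrite ltr_pdivlMr// => /(le_lt_trans _); apply.
by rewrite mulrC ler_wpM2l ?mdist_ge0// lerDl.
Unshelve. all: by end_near. Qed.

(** The distance to [A], truncated at 1: this keeps it bounded, and gives the
    value 1 rather than the junk infimum of an empty set when [A] is empty. *)
Definition tdist (A : set Y) (x : Y) : R :=
  inf ([set mdist x a | a in A] `|` [set 1]).

Let tdist_has_inf A x : has_inf ([set mdist x a | a in A] `|` [set 1]).
Proof.
split; first by exists 1; right.
by exists 0 => _ [[a _ <-]|->//]; exact: mdist_ge0.
Qed.

Lemma tdist_le1 A x : tdist A x <= 1.
Proof. by apply: ge_inf; [exact: (tdist_has_inf A x).2|right]. Qed.

Lemma tdist_le A x a : A a -> tdist A x <= mdist x a.
Proof.
by move=> Aa; apply: ge_inf; [exact: (tdist_has_inf A x).2|left; exists a].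
Qed.

Lemma le_tdist A x r : r <= 1 -> (forall a, A a -> r <= mdist x a) ->
  r <= tdist A x.
Proof.
move=> r1 rA; apply: lb_le_inf; first exact: (tdist_has_inf A x).1.
by move=> _ [[a Aa <-]|->//]; exact: rA.
Qed.

Lemma tdist_ge0 A x : 0 <= tdist A x.
Proof. by apply: le_tdist => // a _; exact: mdist_ge0. Qed.

Lemma tdist_eq0 A x : A x -> tdist A x = 0.
Proof.
move=> Ax; apply/eqP; rewrite eq_le tdist_ge0 andbT.
by rewrite (le_trans (tdist_le _ Ax))// mdistxx.
Qed.

Lemma tdist_gt0 (U : set Y) x : open U -> U x -> 0 < tdist (~` U) x.
Proof.
move=> oU Ux; have /nbhs_ballP[e /= e0 xeU] : nbhs x U by exact: open_nbhs_nbhs.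
have : Num.min e 1 <= tdist (~` U) x; last first.
  by apply: lt_le_trans; rewrite lt_min e0 ltr01.
apply: le_tdist; first by rewrite ge_min lexx orbT.
move=> a Ua; rewrite ge_min; apply/orP; left; rewrite leNgt; apply/negP => xae.
by apply/Ua/xeU; rewrite ballEmdist.
Qed.

Lemma tdist_BLball A : BLball 1 (tdist A).
Proof.
split=> [x|].
  by rewrite ger0_norm ?tdist_ge0// tdist_le1.
have tri x y : tdist A x <= tdist A y + mdist x y.
  rewrite -lerBlDr; apply: le_tdist.
    by rewrite lerBlDr (le_trans (tdist_le1 _ _))// lerDl mdist_ge0.
  move=> a Aa; rewrite lerBlDr addrC (le_trans (tdist_le _ Aa))//.
  exact: metric_triangle.
move=> x y; have := tri y x; have := tri x y; rewrite mul1r (metric_sym y x).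
by move=> ? ?; rewrite ler_norml; apply/andP; split; lra.
Qed.

Lemma BL_tdist A : BL (tdist A).
Proof. by exists 1 => //; exact: tdist_BLball. Qed.

End bounded_lipschitz.

(** * Borel probability measures and bounded Lipschitz functions *)

Section integration.
Context {R : realType} {Y : completeMetricType R}.
Implicit Types (f g : Y -> R) (mu nu : probability (borel Y) R).

Lemma open_measurable_borel (U : set Y) :
  open U -> measurable (U : set (borel Y)).
Proof. by move=> oU; apply: sub_sigma_algebra. Qed.

Lemma continuous_measurable_borel f :
  continuous f -> measurable_fun [set: borel Y] f.
Proof.
move=> cf.
apply: (measurability _ (measurable_realfun.RGenOInfty.measurableE R)) => //.
move=> _ [_ [a ->] <-]; rewrite setTI; apply: open_measurable_borel.
by apply: open_comp => //; exact: interval_open.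
Qed.

Lemma BL_measurable f : BL f -> measurable_fun [set: borel Y] f.
Proof. by move=> /BL_continuous; exact: continuous_measurable_borel. Qed.

Lemma BL_superlevel_measurable f :
  BL f -> measurable ([set x | 1 <= f x] : set (borel Y)).
Proof.
move=> bf; rewrite -[X in measurable X]setTI.
have -> : [set x | 1 <= f x] = f @^-1` `[1, +oo[%classic.
  by apply/seteqP; split=> x /=; rewrite in_itv/= andbT.
exact: BL_measurable.
Qed.

Lemma BL_integrable mu f : BL f -> mu.-integrable [set: borel Y] (EFin \o f).
Proof.
move=> bf; apply: measurable_bounded_integrable => //.
- by rewrite -ge0_fin_numE ?fin_num_measure.
- exact: BL_measurable.
- case: bf => k _ [fk _]; exists k; split; first exact: num_real.
  by move=> l kl x _ /=; rewrite (le_trans (fk x))// ltW.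
Qed.

Lemma BL_RintegralD mu f g : BL f -> BL g ->
  \int[mu]_y (f y + g y) = \int[mu]_y f y + \int[mu]_y g y.
Proof. by move=> bf bg; rewrite RintegralD//; exact: BL_integrable. Qed.

Lemma BL_RintegralZ mu c f : BL f ->
  \int[mu]_y (c * f y) = c * \int[mu]_y f y.
Proof. by move=> bf; rewrite RintegralZl//; exact: BL_integrable. Qed.

Lemma BL_le_Rintegral mu f g : BL f -> BL g -> (forall x, f x <= g x) ->
  \int[mu]_y f y <= \int[mu]_y g y.
Proof. by move=> bf bg fg; apply: le_Rintegral => //; exact: BL_integrable. Qed.

Lemma probability_Rintegral_cst mu c : \int[mu]_y (cst c y) = c.
Proof. by rewrite Rintegral_cst//= probability_setT mulr1. Qed.

Lemma le_norm_BL_Rintegral mu k f : BLball k f -> `|\int[mu]_y f y| <= k.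
Proof.
move=> kf; have bf : BL f by exists k.
have [fk _] := kf.
have fk' x : - k <= f x <= k by rewrite -ler_norml.
rewrite ler_norml -{1}(probability_Rintegral_cst mu (- k)).
rewrite -{2}(probability_Rintegral_cst mu k).
by apply/andP; split; apply: BL_le_Rintegral => //=; try exact: BL_cst;
  move=> x; have /andP[] := fk' x.
Qed.

(** All fields of the probability structure on a fixed set function are proofs
    of propositions, hence equal. *)
Lemma probability_ext mu nu : mu = nu :> (set (borel Y) -> \bar R) -> mu = nu.
Proof.
case: mu nu => [m cm] [m' cm'] /= mm'; case: _ / mm' cm' => cm'.
congr Probability.Pack.
move: cm cm' => [[a b] [c] [d] [e] [f] [g] [h]].
move=> [[a' b'] [c'] [d'] [e'] [f'] [g'] [h']].
rewrite (Prop_irrelevance a' a) (Prop_irrelevance b' b).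
rewrite (Prop_irrelevance c' c) (Prop_irrelevance d' d).
rewrite (Prop_irrelevance e' e) (Prop_irrelevance f' f).
by rewrite (Prop_irrelevance g' g) (Prop_irrelevance h' h).
Qed.

Lemma Q_ext (mu nu : Q Y) :
  (forall A : set (borel Y), measurable A -> mu A = nu A) -> mu = nu.
Proof.
case: mu nu => [mu mu0] [nu nu0] /= munu.
have : mu = nu.
  apply: probability_ext; apply/funext => A.
  have [/munu//|nA] := pselect (measurable A).
  by rewrite mu0// nu0.
move=> e; case: _ / e nu0 {munu} => nu0; congr BorelProbability.
exact: Prop_irrelevance.
Qed.

(** The functions [min 1 (n * d(x, ~U))] increase to the indicator of the open
    set [U]. *)
Lemma BL_Rintegral_open_cvg mu (U : set Y) : open U ->
  (\int[mu]_y Num.min 1 (n%:R * tdist (~` U) y))%:E @[n --> \oo] --> mu U.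
Proof.
move=> oU; have mU := open_measurable_borel oU.
pose g n (x : Y) : R := Num.min 1 (n%:R * tdist (~` U) x).
have bg n : BL (g n) by apply: BL_min; [exact: BL_cst|exact/BLZ/BL_tdist].
have -> : (fun n => (\int[mu]_y Num.min 1 (n%:R * tdist (~` U) y))%:E) =
    (fun n => \int[mu]_y (g n y)%:E)%E.
  apply/funext => n; rewrite /Rintegral fineK//.
  exact: (integrable_fin_num measurableT (BL_integrable mu (bg n))).
rewrite -[in X in _ --> X](setIT U) -(@integral_indic _ _ _ mu setT)//.
have -> : (\int[mu]_x (\1_U x)%:E = \int[mu]_x (limn (fun n => (g n x)%:E)))%E.
  apply: eq_integral => x _; apply/esym/cvg_lim => //.
  apply: cvg_near_cst; rewrite indicE.
  have [/set_mem Ux|/negP nUx] := boolP (x \in U).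
    have d0 := tdist_gt0 oU Ux.
    near=> n; rewrite /g/= min_l// -ler_pdivrMr// mul1r.
    by near: n; exact: nbhs_infty_ger.
  apply: nearW => n; rewrite /g tdist_eq0 ?mulr0 ?min_r//.
  by apply: contra_not nUx => Ux; exact/mem_set.
apply: cvg_monotone_convergence => //.
- by move=> n; exact: (measurable_int mu (BL_integrable mu (bg n))).
- by move=> n x _; rewrite lee_fin le_min ler01 mulr_ge0// tdist_ge0.
- move=> x _ m n mn; rewrite lee_fin /g; apply: le_min2 => //.
  by rewrite ler_wpM2r ?tdist_ge0// ler_nat.
Unshelve. all: by end_near. Qed.


Lemma BL_separates_Q (mu nu : Q Y) :
  (forall f, BL f -> \int[mu]_y f y = \int[nu]_y f y) -> mu = nu.
Proof.
move=> munu; apply: Q_ext => A mA.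
pose g : (set (borel Y))^nat := fun=> setT.
apply: (@g_sigma_algebra_measure_unique _ R (borel Y) (@open Y) _ g) => //.
- by move=> U; exact: open_measurable_borel.
- by move=> i; exact: openT.
- by rewrite bigcup_const.
- by move=> U V; exact: openI.
- move=> U oU.
  have bU n : BL (fun y => Num.min 1 (n%:R * tdist (~` U) y)).
    by apply: BL_min; [exact: BL_cst|exact/BLZ/BL_tdist].
  have := @BL_Rintegral_open_cvg mu U oU.
  under eq_fun do rewrite (munu _ (bU _)).
  move/(cvg_unique (@ereal_hausdorff R)); apply.
  exact: (@BL_Rintegral_open_cvg nu U oU).
- by move=> i; rewrite /g -ge0_fin_numE ?fin_num_measure.
Qed.

End integration.

(** * Tight positive functionals *)

Lemma ultra_big_or T (I : eqType) (G : set_system T) (s : seq I)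
    (A : I -> set T) :
  UltraFilter G -> G [set x | exists2 i, i \in s & A i x] ->
  exists2 i, i \in s & G (A i).
Proof.
move=> UG; elim: s => [|i s ih] Gs.
  suff : G set0 by move/filter_not_empty.
  by apply: filterS Gs => x [].
have [GAi|GCi] := in_ultra_setVsetC (A i) UG.
  by exists i; rewrite ?mem_head.
have [|j js GAj] := ih; last by exists j; rewrite // inE js orbT.
apply: filterS (filterI Gs GCi) => x [[j + Aj]] nAi.
by rewrite inE => /predU1P[ji|js]; [rewrite ji in Aj|exists j].
Qed.

Section tight_mean.
Context {R : realType} {Y : completeMetricType R}.
Implicit Types (f g : Y -> R).

(** A normalized positive linear functional on bounded Lipschitz functions that
    almost ignores what happens away from suitable finite unions of balls of any
    prescribed radius. *)
Record tight_mean (L : (Y -> R) -> R) : Prop := TightMean {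
  meanD : forall f g, BL f -> BL g -> L (fun x => f x + g x) = L f + L g ;
  meanZ : forall c f, BL f -> L (fun x => c * f x) = c * L f ;
  mean_le : forall f g, BL f -> BL g -> (forall x, f x <= g x) -> L f <= L g ;
  mean1 : L (fun=> 1) = 1 ;
  mean_tight : forall e d, 0 < e -> 0 < d -> exists s : seq Y,
    L (tdist [set x | exists2 a, a \in s & ball a d x]) <= e }.

Context (L : (Y -> R) -> R) (tL : tight_mean L).

Lemma mean_cst c : L (fun=> c) = c.
Proof.
by rewrite -[RHS]mulr1 -(mean1 tL) -(meanZ tL) ?mulr1//; exact: BL_cst.
Qed.

Lemma meanB f g : BL f -> BL g -> L (fun x => f x - g x) = L f - L g.
Proof.
move=> bf bg; rewrite -mulN1r -(meanZ tL)// -(meanD tL)//; last exact: BLZ.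
by congr L; apply/funext => x; rewrite mulN1r.
Qed.

Lemma mean_ge0 f : BL f -> (forall x, 0 <= f x) -> 0 <= L f.
Proof.
by move=> bf f0; rewrite -(mean_cst 0) (mean_le tL)//; exact: BL_cst.
Qed.

Lemma mean_sum n (F : nat -> Y -> R) : (forall i, BL (F i)) ->
  L (fun x => \sum_(i < n) F i x) = \sum_(i < n) L (F i).
Proof.
move=> bF; elim: n => [|n ih].
  rewrite big_ord0 -[RHS]mean_cst.
  by congr L; apply/funext => x; rewrite big_ord0.
rewrite big_ord_recr/= -ih -(meanD tL)//; last exact: BL_sum.
by congr L; apply/funext => x; rewrite big_ord_recr.
Qed.

(** A multiple of the truncated distance to the [d / 2]-neighborhood of [s]
    reaches 1 outside the [d]-neighborhood. *)
Lemma mean_tight_bump e d : 0 < e -> 0 < d -> exists (s : seq Y) phi,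
  [/\ BL phi, forall x, 0 <= phi x, L phi <= e &
      forall x, (forall a, a \in s -> d <= mdist a x) -> 1 <= phi x].
Proof.
move=> e0 d0; pose r := Num.min (d / 2) 1.
have r0 : 0 < r by rewrite lt_min ltr01 divr_gt0.
have [s Ls] := mean_tight tL (mulr_gt0 r0 e0) (divr_gt0 d0 (ltr0Sn R 1)).
set B := [set x | _] in Ls; exists s, (fun x => r^-1 * tdist B x); split.
- exact/BLZ/BL_tdist.
- by move=> x; rewrite mulr_ge0 ?tdist_ge0// invr_ge0 ltW.
- rewrite (meanZ tL); last exact: BL_tdist.
  by rewrite mulrC ler_pdivrMr// mulrC.
- move=> x xs; rewrite mulrC ler_pdivlMr// mul1r.
  apply: le_tdist; first by rewrite ge_min lexx orbT.
  move=> b [a aS]; rewrite ballEmdist/= => ab; rewrite ge_min; apply/orP; left.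
  have := xs _ aS; have := metric_triangle a b x.
  by rewrite (metric_sym x b); lra.
Qed.

Lemma sum_geometric_half_lt1 n : \sum_(i < n) (2 ^- i.+1 : R) < 1.
Proof.
suff -> : \sum_(i < n) (2 ^- i.+1 : R) = 1 - 2 ^- n.
  by rewrite ltrBlDr ltrDl invr_gt0 exprn_gt0.
elim: n => [|n ih]; first by rewrite big_ord0 expr0 invr1 subrr.
by rewrite big_ord_recr ih/= exprS invfM; lra.
Qed.

(** Daniell continuity, with Prokhorov's compactness argument inlined.  If
    [L (g n)] stayed above [e], subtracting the bumps [phi k], which together
    cost at most [e / 3], would leave points [x_ n] with [g n (x_ n) > e / 3]
    lying in all neighborhoods number [k < n].  An ultrafilter containing the
    tails of [x_] then contains balls of every radius, hence converges, and
    [g] cannot tend to 0 at its limit. *)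
Lemma mean_daniell (g : nat -> Y -> R) :
  (forall n, BL (g n)) -> (forall n x, g n x <= 1) ->
  (forall m n x, (m <= n)%N -> g n x <= g m x) ->
  (forall x e, 0 < e -> exists n, g n x < e) ->
  forall e, 0 < e -> exists n, L (g n) <= e.
Proof.
move=> bg g1 ndg g0 e e0; apply: contrapT => /forallNP ge.
have e3 : 0 < e / 3 by rewrite divr_gt0.
have /choice[S /choice[phi Sphi]] k : exists (s : seq Y) phi,
    [/\ BL phi, forall x, 0 <= phi x, L phi <= e / 3 * 2 ^- k.+1 &
        forall x, (forall a, a \in s -> k.+1%:R^-1 <= mdist a x) -> 1 <= phi x].
  by apply: mean_tight_bump; rewrite ?mulr_gt0 ?invr_gt0 ?exprn_gt0.
have bphi k : BL (phi k) by case: (Sphi k).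
have /choice[x_ x_P] n : exists x, e / 3 + \sum_(k < n) phi k x < g n x.
  apply: contrapT => /forallNP nx; apply: (ge n).
  have : L (g n) <= L (fun x => e / 3 + \sum_(k < n) phi k x).
    apply: (mean_le tL) => //.
      by apply: BLD; [exact: BL_cst|exact: BL_sum].
    by move=> x; rewrite leNgt; exact/negP/nx.
  rewrite (meanD tL) ?mean_cst ?mean_sum//; [|exact: BL_cst|exact: BL_sum].
  move=> /le_trans; apply.
  have : \sum_(k < n) L (phi k) <= e / 3.
    apply: (@le_trans _ _ (\sum_(k < n) e / 3 * 2 ^- k.+1)).
      by apply: ler_sum => k _; case: (Sphi k).
    by rewrite -mulr_sumr -[leRHS]mulr1 ler_wpM2l ?ltW// sum_geometric_half_lt1.
  lra.
have [G [UG subG]] := @ultraFilterLemma _ (x_ @ \oo) _.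
have xG N : G [set y | exists2 n, (N <= n)%N & y = x_ n].
  by apply: subG; exists N => // n /= Nn; exists n.
(* Each bump [phi k] is below 1 at [x_ n] for [n > k], so the tail of [x_] is
   covered by finitely many balls, one of which belongs to the ultrafilter. *)
have cG : cauchy G.
  apply: cauchy_exP => d d0; have [k dk] : exists k, k.+1%:R^-1 < d.
    have [k _ kd] := near_infty_natSinv_lt (PosNum d0).
    by exists k; exact: (kd k (leqnn _)).
  have [|a aS Ga] :=
    @ultra_big_or _ _ G (S k) (fun a => ball a (k.+1%:R^-1)) UG.
    apply: filterS (xG k.+1) => _ [n kn ->]; apply: contrapT => nS.
    have [_ phi0 _ phi1] := Sphi k.
    have : 1 <= phi k (x_ n).
      apply: phi1 => a aS; rewrite leNgt; apply/negP => xd.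
      by apply: nS; exists a => //; rewrite ballEmdist.
    have := x_P n; rewrite (bigD1 (Ordinal kn))//=.
    have : 0 <= \sum_(i < n | i != Ordinal kn) phi i (x_ n).
      by apply: sumr_ge0 => i _; case: (Sphi i).
    have := g1 n (x_ n); lra.
  by exists a; apply: filterS Ga; apply: le_ball; exact: ltW.
have /cvg_ex[p Gp] : cvg G by exact: cauchy_cvg.
have [N gN] := g0 p _ e3.
have GN : G [set y | g N y < e / 3].
  have gNp := @BL_continuous _ _ _ (bg N) p.
  by apply: Gp; exact: (cvgr_lt (g N p) gNp (e / 3) gN).
have [y [gy [n Nn yE]]] := filter_ex (filterI GN (xG N)).
have : e / 3 <= g n (x_ n).
  rewrite (le_trans _ (ltW (x_P n)))// lerDl.
  by apply: sumr_ge0 => i _; case: (Sphi i).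
by have := ndg _ _ (x_ n) Nn; move: gy; rewrite yE/=; lra.
Qed.

End tight_mean.

(** * The outer measure of a tight functional *)

Section representation.
Context {R : realType} {Y : completeMetricType R}.
Implicit Types (f g : Y -> R) (A B : set Y) (c : R).
Context (L : (Y -> R) -> R) (tL : tight_mean L).

(** The limit of the [f n] is a function dominating the indicator of [A], on
    which any extension of [L] continuous along increasing sequences is at most
    [c].  That 1 is actually attained, and not just approached, spares an
    epsilon in the unions and complements below. *)
Definition covers A c := exists f : nat -> Y -> R,
  [/\ forall n, BL (f n), forall n x, 0 <= f n x,
      forall m n x, (m <= n)%N -> f m x <= f n x,
      forall n, L (f n) <= c & forall x, A x -> exists n, 1 <= f n x].

Definition mass A : R := inf (covers A).

Lemma covers_ge0 A c : covers A c -> 0 <= c.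
Proof.
by move=> [f [bf f0 _ Lf _]]; rewrite (le_trans _ (Lf 0%N))// (mean_ge0 tL).
Qed.

Lemma coversS A B c : A `<=` B -> covers B c -> covers A c.
Proof. by move=> AB [f [bf f0 ndf Lf Bf]]; exists f; split=> // x /AB/Bf. Qed.

Lemma coversW A c d : c <= d -> covers A c -> covers A d.
Proof.
move=> cd [f [bf f0 ndf Lf Af]]; exists f; split=> // n.
exact: le_trans (Lf n) cd.
Qed.

Lemma covers_cst A f : BL f -> (forall x, 0 <= f x) ->
  (forall x, A x -> 1 <= f x) -> covers A (L f).
Proof.
by move=> bf f0 Af; exists (fun=> f); split=> // x /Af; exists 0%N.
Qed.

Lemma covers1 A : covers A 1.
Proof.
by rewrite -(mean1 tL); apply: covers_cst => //; exact: BL_cst.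
Qed.

Lemma has_inf_covers A : has_inf (covers A).
Proof.
by split; [exists 1; exact: covers1|exists 0 => c; exact: covers_ge0].
Qed.

Lemma mass_le A c : covers A c -> mass A <= c.
Proof. by move=> Ac; apply: ge_inf => //; exact: (has_inf_covers A).2. Qed.

Lemma le_mass A c : (forall d, covers A d -> c <= d) -> c <= mass A.
Proof. by move=> Ac; apply: lb_le_inf => //; exact: (has_inf_covers A).1. Qed.

Lemma covers_mass A e : 0 < e -> covers A (mass A + e).
Proof.
move=> e0; have [c Ac] := inf_adherent e0 (has_inf_covers A).
by move=> /ltW/coversW; exact.
Qed.

Lemma mass_ge0 A : 0 <= mass A.
Proof. by apply: le_mass => c; exact: covers_ge0. Qed.

Lemma massS A B : A `<=` B -> mass A <= mass B.
Proof. by move=> AB; apply: le_mass => c /(coversS AB); exact: mass_le. Qed.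

Lemma mass0 : mass set0 = 0.
Proof.
apply/eqP; rewrite eq_le mass_ge0 andbT -(mean_cst tL 0).
by apply: mass_le; apply: covers_cst => //; exact: BL_cst.
Qed.

(** This rests on the tightness of [L], not just on its positivity: if the [f n]
    increase and reach 1 everywhere, the positive parts of [1 - f n] decrease
    to 0, so by Daniell continuity [L (f n)] comes close to 1. *)
Lemma massT : mass setT = 1.
Proof.
apply/eqP; rewrite eq_le mass_le/=; last exact: covers1.
apply: le_mass => c [f [bf f0 ndf Lf f1]]; apply/ler_addgt0Pr => e e0.
have bg n : BL (fun x => Num.max 0 (1 - f n x)).
  by apply: BL_max; [exact: BL_cst|apply: BLB => //; exact: BL_cst].
have [||||n Lg] := mean_daniell tL
  (g := fun n x => Num.max 0 (1 - f n x)) _ _ _ _ e0.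
- exact: bg.
- by move=> n x; rewrite ge_max ler01/= gerBl.
- by move=> m n x mn; apply: le_max2 => //; rewrite lerB// ndf.
- move=> x d d0; have [//|n fn] := f1 x; exists n.
  by rewrite gt_max d0 (le_lt_trans _ d0)// subr_le0.
have : L (fun x => 1 - f n x) <= L (fun x => Num.max 0 (1 - f n x)).
  apply: (mean_le tL) => //; first by apply: BLB => //; exact: BL_cst.
  by move=> x; rewrite le_max lexx orbT.
rewrite (meanB tL)// ?(mean1 tL); last exact: BL_cst.
by have := Lf n; lra.
Qed.

(** The diagonal sums [\sum_(i < n) f i n] form again an increasing sequence, so
    that no double series is needed. *)
Lemma covers_bigcup (A : nat -> set Y) (c : nat -> R) C :
  (forall i, covers (A i) (c i)) -> (forall n, \sum_(i < n) c i <= C) ->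
  covers (\bigcup_i A i) C.
Proof.
move=> /choice[f fP] cC; exists (fun n x => \sum_(i < n) f i n x).
have f0 i n x : 0 <= f i n x by case: (fP i).
have bf i n : BL (f i n) by case: (fP i).
split.
- by move=> n; apply: (@BL_sum _ _ n (fun i => f i n)).
- by move=> n x; apply: sumr_ge0.
- move=> m n x mn; rewrite (big_ord_widen n (fun i => f i m x) mn).
  rewrite [leLHS]big_mkcond/=; apply: ler_sum => i _; case: ifP => // _.
  by have [_ _ ndf _ _] := fP i; exact: ndf.
- move=> n; rewrite (@mean_sum _ _ _ tL n (fun i => f i n))//.
  apply: le_trans (cC n); apply: ler_sum => i _.
  by have [_ _ _ Lf _] := fP i; exact: Lf.
- move=> x [i _ Aix]; have [_ _ ndf _ /(_ x Aix)[n fn]] := fP i.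
  exists (maxn n i.+1); have iN : (i < maxn n i.+1)%N by rewrite leq_maxr.
  rewrite (bigD1 (Ordinal iN))//= (le_trans fn)// -[leLHS]addr0.
  by rewrite lerD// ?ndf ?leq_maxl// sumr_ge0.
Qed.

Lemma mass_sigma_subadditive (A : nat -> set Y) :
  ((mass (\bigcup_i A i))%:E <= \sum_(i <oo) (mass (A i))%:E)%E.
Proof.
apply/lee_addgt0Pr => e e0.
have := leey (\sum_(i <oo) (mass (A i))%:E)%E.
rewrite le_eqVlt => /predU1P[->|Coo]; first by rewrite addye// leey.
have C0 : (0 <= \sum_(i <oo) (mass (A i))%:E)%E.
  by apply: nneseries_ge0 => i _ _; rewrite lee_fin mass_ge0.
have CE : (\sum_(i <oo) (mass (A i))%:E)%E \is a fin_num.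
  by rewrite ge0_fin_numE.
rewrite -(fineK CE) -EFinD lee_fin; apply: mass_le.
apply: (covers_bigcup (c := fun i => mass (A i) + e * 2 ^- i.+1)) => [i|n].
  by apply: covers_mass; rewrite mulr_gt0// invr_gt0 exprn_gt0.
rewrite big_split/= -mulr_sumr lerD//; last first.
  by rewrite -[leRHS]mulr1 ler_wpM2l ?ltW// sum_geometric_half_lt1.
rewrite -lee_fin fineK// -sumEFin.
rewrite -(big_mkord xpredT (fun i => (mass (A i))%:E)).
by apply: nneseries_lim_ge => i _ _; rewrite lee_fin mass_ge0.
Qed.

(** Caratheodory's criterion for open sets.  Let [f] cover [A] with bound [c],
    and let [g n = min (f n) (n * d(., ~U))], which vanishes off [U] and covers
    [A `&` U].  For each fixed [m] the sequence [f (n + m) - g m] covers the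
    rest of [A] with bound [c - L (g m)]; so [L (g m) <= c - mass (A `&` ~` U)]
    for all [m], which bounds the mass of [A `&` U]. *)
Lemma mass_open_split (U A : set Y) : open U ->
  mass (A `&` U) + mass (A `&` ~` U) <= mass A.
Proof.
move=> oU; apply: le_mass => c [f [bf f0 ndf Lf Af]].
pose g n x := Num.min (f n x) (n%:R * tdist (~` U) x).
have bg n : BL (g n) by apply: BL_min => //; exact/BLZ/BL_tdist.
have ndg m n x : (m <= n)%N -> g m x <= g n x.
  move=> mn; apply: le_min2; first exact: ndf.
  by rewrite ler_wpM2r ?tdist_ge0// ler_nat.
have gf n x : g n x <= f n x by rewrite /g ge_min lexx.
have outside m : mass (A `&` ~` U) <= c - L (g m).
  apply: mass_le; exists (fun n x => f (n + m)%N x - g m x); split.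
  - by move=> n; exact: BLB.
  - by move=> n x; rewrite subr_ge0 (le_trans (gf m x))// ndf// leq_addl.
  - by move=> n p x np; rewrite lerB// ndf// leq_add2r.
  - by move=> n; rewrite (meanB tL)// lerB.
  - move=> x [/Af[n fn] nUx]; exists n.
    rewrite /g tdist_eq0// mulr0 min_r// subr0 (le_trans fn)//.
    by rewrite ndf// leq_addr.
suff : mass (A `&` U) <= c - mass (A `&` ~` U) by lra.
apply: mass_le; exists g; split=> //.
- by move=> n x; rewrite le_min f0 mulr_ge0// tdist_ge0.
- by move=> n; have := outside n; lra.
- move=> x [/Af[n fn] Ux]; have d0 := tdist_gt0 oU Ux.
  have [m md] : exists m : nat, (tdist (~` U) x)^-1 <= m%:R.
    exists (Num.bound (tdist (~` U) x)^-1).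
    by rewrite ltW// archi_boundP// invr_ge0 ltW.
  exists (maxn n m); rewrite le_min (le_trans fn) ?ndf ?leq_maxl//=.
  by rewrite -ler_pdivrMr// mul1r (le_trans md)// ler_nat leq_maxr.
Qed.

End representation.

(** * The representing measure *)

Section representing_measure.
Context {R : realType} {Y : completeMetricType R}.
Context (L : (Y -> R) -> R) (tL : tight_mean L).

(** The proof that [L] is a tight mean is an argument here so that the outer
    measure structure, which depends on it, can be attached canonically. *)
Definition outer_mass of tight_mean L := fun A : set Y => (mass L A)%:E.

Let outer_mass0 : outer_mass tL set0 = 0%E.
Proof. by rewrite /outer_mass (mass0 tL). Qed.

Let outer_mass_ge0 A : (0 <= outer_mass tL A)%E.
Proof. by rewrite lee_fin (mass_ge0 tL). Qed.

Let le_outer_mass : {homo outer_mass tL : A B / A `<=` B >-> (A <= B)%E}.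
Proof. by move=> A B AB; rewrite lee_fin (massS tL). Qed.

Let outer_mass_sigma_subadditive : sigma_subadditive (outer_mass tL).
Proof. by move=> F; exact: mass_sigma_subadditive. Qed.

HB.instance Definition _ := isOuterMeasure.Build R Y (outer_mass tL)
  outer_mass0 outer_mass_ge0 le_outer_mass outer_mass_sigma_subadditive.

Lemma borel_caratheodory (A : set (borel Y)) :
  measurable A -> (outer_mass tL).-cara.-measurable (A : set Y).
Proof.
move: A; apply: (@smallest_sub _ (sigma_algebra setT) _ _
  (@sigma_algebra_measurable _ (caratheodory_type (outer_mass tL)))) => U oU.
apply: le_caratheodory_measurable => X.
by rewrite -EFinD lee_fin (mass_open_split tL).
Qed.

(** Elements of [Q Y] vanish outside the Borel sets. *)
Definition borel_mass of tight_mean L := fun A : set (borel Y) =>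
  if pselect (measurable A) then (mass L A)%:E else 0%E.

Lemma borel_massE (A : set (borel Y)) : measurable A ->
  borel_mass tL A = (mass L A)%:E.
Proof. by rewrite /borel_mass; case: pselect. Qed.

Let borel_mass0 : borel_mass tL set0 = 0%E.
Proof. by rewrite borel_massE// (mass0 tL). Qed.

Let borel_mass_ge0 A : (0 <= borel_mass tL A)%E.
Proof.
by rewrite /borel_mass; case: pselect => // mA; rewrite lee_fin (mass_ge0 tL).
Qed.

Let borel_mass_sigma_additive : semi_sigma_additive (borel_mass tL).
Proof.
move=> F mF tF mUF; rewrite borel_massE//.
under eq_fun do under eq_bigr do rewrite borel_massE//.
apply: (@caratheodory_measure_sigma_additive _ _ (outer_mass tL)) => //.
- by move=> i; exact: borel_caratheodory.
- exact: borel_caratheodory.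
Qed.

HB.instance Definition _ := isMeasure.Build _ _ _ (borel_mass tL)
  borel_mass0 borel_mass_ge0 borel_mass_sigma_additive.

Let borel_mass_setT : borel_mass tL setT = 1%E.
Proof. by rewrite borel_massE// (massT tL). Qed.

HB.instance Definition _ :=
  Measure_isProbability.Build _ _ _ (borel_mass tL) borel_mass_setT.

Lemma borel_mass_out (A : set (borel Y)) :
  ~ measurable A -> borel_mass tL A = 0%E.
Proof. by rewrite /borel_mass; case: pselect. Qed.

Definition mean_measure : Q Y := BorelProbability borel_mass_out.

Lemma mean_measure_superlevel_le (f : Y -> R) : BL f -> (forall x, 0 <= f x) ->
  (mean_measure [set x | (1 <= f x)%R] <= (L f)%:E)%E.
Proof.
move=> bf f0; have mf := BL_superlevel_measurable bf.
rewrite /= borel_massE// lee_fin; apply: (mass_le tL).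
exact: (covers_cst L).
Qed.

End representing_measure.

Section representation_formula.
Context {R : realType} {Y : completeMetricType R}.
Context (L : (Y -> R) -> R) (tL : tight_mean L).
Local Notation mu := (mean_measure tL).
Implicit Types f : Y -> R.

Let BL_excess f : BL f -> BL (fun x => Num.max 0 (f x - 1)).
Proof.
by move=> bf; apply: BL_max; [exact: BL_cst|apply: BLB => //; exact: BL_cst].
Qed.

(** The function [h] is below the indicator of the set where [1 <= f], whose
    mass is at most the value of [L] at any function that dominates the
    indicator. *)
Lemma Rintegral_le_superlevel f h : BL f -> BL h -> (forall x, 0 <= f x) ->
  (forall x, h x <= 1) -> (forall x, f x < 1 -> h x <= 0) ->
  \int[mu]_y h y <= L (fun x => Num.min 1 (f x)).
Proof.
move=> bf bh f0 h1 h0; pose m x := Num.min 1 (f x).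
have bm : BL m by apply: BL_min => //; exact: BL_cst.
have m0 x : 0 <= m x by rewrite le_min ler01 f0.
pose A := [set x | 1 <= m x].
have mA : measurable (A : set (borel Y)) by exact: BL_superlevel_measurable.
have iA : mu.-integrable setT (EFin \o (\1_A : borel Y -> R)).
  exact: integrable_indic.
apply: (@le_trans _ _ (\int[mu]_y (\1_A : borel Y -> R) y)).
  apply: le_Rintegral => //; first exact: BL_integrable.
  move=> x _; rewrite indicE; have [//|xA] := boolP (x \in A).
  apply: h0; rewrite ltNge; apply: contra xA => fx.
  by apply/mem_set; rewrite /A/= /m le_min lexx.
rewrite /Rintegral integral_indic// setIT -lee_fin fineK ?fin_num_measure//.
exact: mean_measure_superlevel_le.
Qed.

(** A layer-cake estimate.  With [h = max 0 (f - 1)], cutting at height 1 writes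
    [f = min 1 f + h] on the side of [L], and [h = min 1 h + max 0 (h - 1)] on
    the side of the integral; the first terms compare since [min 1 h] lives
    where [1 <= f], and the second ones by induction on the height of [f]. *)
Lemma Rintegral_excess_le n f : BL f -> (forall x, 0 <= f x <= n%:R) ->
  \int[mu]_y Num.max 0 (f y - 1) <= L f.
Proof.
elim: n f => [|n ih] f bf fn.
  have f0 x : 0 <= f x by case/andP: (fn x).
  have -> : (fun y => Num.max 0 (f y - 1)) = cst 0.
    apply/funext => x; have /andP[_ fx0] := fn x.
    by rewrite max_l// subr_le0 (le_trans fx0).
  by rewrite probability_Rintegral_cst (mean_ge0 tL).
pose h x := Num.max 0 (f x - 1); have bh : BL h by exact: BL_excess.
have f0 x : 0 <= f x by case/andP: (fn x).
have -> : (fun y => Num.max 0 (f y - 1)) =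
          (fun y => Num.min 1 (h y) + Num.max 0 (h y - 1)).
  apply/funext => x; rewrite -/(h x); have : 0 <= h x by rewrite le_max lexx.
  by case: (lerP 1 (h x)); case: (lerP 0 (h x - 1)); lra.
have b1 : BL (fun x => Num.min 1 (h x)) by apply: BL_min => //; exact: BL_cst.
have b2 : BL (fun x => Num.min 1 (f x)) by apply: BL_min => //; exact: BL_cst.
rewrite BL_RintegralD//; last exact: BL_excess.
have -> : L f = L (fun x => Num.min 1 (f x)) + L h.
  rewrite -(meanD tL)//; congr L; apply/funext => x; rewrite /h.
  by case: (lerP 1 (f x)); case: (lerP 0 (f x - 1)); lra.
apply: lerD.
  apply: Rintegral_le_superlevel => //.
  - by move=> x; rewrite ge_min lexx.
  - by move=> x fx1; rewrite ge_min /h ge_max lexx subr_le0 (ltW fx1) orbT.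
apply: ih => // x; have /andP[_ fx] := fn x.
by rewrite /h le_max lexx/= ge_max ler0n lerBlDr natr1.
Qed.

Let Rintegral_le f : BL f -> (forall x, 0 <= f x) -> \int[mu]_y f y <= L f.
Proof.
have le1 g : BL g -> (forall x, 0 <= g x) -> \int[mu]_y g y <= L g + 1.
  move=> bg g0; have [k _ [gk _]] := bg.
  have k0 : 0 <= k by rewrite (le_trans _ (gk point)).
  have gn x : 0 <= g x <= (Num.bound k)%:R.
    rewrite g0/= (le_trans (ler_norm _))// (le_trans (gk x))//.
    by rewrite ltW// archi_boundP.
  have := Rintegral_excess_le bg gn.
  rewrite -(lerD2r 1); apply: le_trans.
  have bmax := BL_excess bg.
  have := BL_RintegralD mu bmax (BL_cst 1).
  rewrite (probability_Rintegral_cst mu 1) => <-.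
  apply: BL_le_Rintegral => //; first by apply: BLD => //; exact: BL_cst.
  by move=> x/=; rewrite -lerBlDr le_max lexx orbT.
(* Applied to [e^-1 * f], the error term 1 becomes [e]. *)
move=> bf f0; apply/ler_addgt0Pr => e e0.
have ei0 : 0 < e^-1 by rewrite invr_gt0.
have := le1 _ (BLZ e^-1 bf) (fun x => mulr_ge0 (ltW ei0) (f0 x)).
rewrite BL_RintegralZ// (meanZ tL)// -(ler_pM2l e0) mulrDr.
by rewrite !mulrA divff ?gt_eqF// !mul1r mulr1.
Qed.

(** The Riesz-Daniell representation of tight functionals. *)
Lemma mean_Rintegral f : BL f -> \int[mu]_y f y = L f.
Proof.
have le g : BL g -> \int[mu]_y g y <= L g.
  move=> bg; have [k _ [gk _]] := bg.
  have bk : BL (cst k : Y -> R) by exact: BL_cst.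
  have : \int[mu]_y (g y + cst k y) <= L (fun y => g y + cst k y).
    apply: Rintegral_le => [|x]; first exact: BLD.
    by have := gk x; rewrite ler_norml /=; lra.
  rewrite BL_RintegralD// (meanD tL)// (mean_cst tL).
  by rewrite probability_Rintegral_cst lerD2r.
move=> bf; apply/eqP; rewrite eq_le le//=.
have := le _ (BLZ (-1) bf); rewrite BL_RintegralZ// (meanZ tL)//; lra.
Qed.

End representation_formula.

(** * The metric [MH] *)

Section MH_metric.
Context {R : realType} {Y : completeMetricType R}.
Implicit Types (f : Y -> R) (mu nu : Q Y).

Lemma Lip1_unitE : Lip1 Y `&` [set f | (supnorm f <= 1)%E] = BLball 1.
Proof.
apply/seteqP; split=> f [].
  move=> lf f1; split=> [x|x y]; last by rewrite mul1r; exact: lf.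
  rewrite -lee_fin (le_trans _ f1)//; apply: ereal_sup_ubound.
  by exists x.
move=> f1 lf; split=> [x y|]; first by rewrite -[leRHS]mul1r; exact: lf.
by apply: ge_ereal_sup => _ [x _ <-]; rewrite lee_fin.
Qed.

Lemma MH_le mu nu c :
  (forall f, BLball 1 f -> `|\int[mu]_y f y - \int[nu]_y f y| <= c) ->
  MH mu nu <= c.
Proof.
move=> munu; rewrite /MH Lip1_unitE; apply: ge_sup.
  exists `|\int[mu]_y cst 0 y - \int[nu]_y cst 0 y|, (cst 0) => //.
  by split=> x *; rewrite /cst ?subrr normr0// mulr_ge0// mdist_ge0.
by move=> _ [f /munu fc <-].
Qed.

Lemma MH_ub mu nu f : BLball 1 f ->
  `|\int[mu]_y f y - \int[nu]_y f y| <= MH mu nu.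
Proof.
move=> f1; rewrite /MH Lip1_unitE; apply: ub_le_sup; last by exists f.
exists (1 + 1) => _ [g g1 <-]; rewrite (le_trans (ler_normB _ _))//.
by rewrite lerD// le_norm_BL_Rintegral.
Qed.

Lemma MH_BLball mu nu k f : 0 < k -> BLball k f ->
  `|\int[mu]_y f y - \int[nu]_y f y| <= k * MH mu nu.
Proof.
move=> k0 kf; have ki0 : 0 <= k^-1 by rewrite invr_ge0 ltW.
have bf : BL f by exists k.
have := BLballM ki0 kf; rewrite mulVf ?gt_eqF// => /(MH_ub mu nu).
rewrite !BL_RintegralZ// -mulrBr normrM (ger0_norm ki0).
by rewrite mulrC ler_pdivrMr// mulrC.
Qed.

Lemma MHxx mu : MH mu mu = 0.
Proof.
apply/eqP; rewrite eq_le; apply/andP; split.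
  by apply: MH_le => f _; rewrite subrr normr0.
by rewrite (le_trans _ (MH_ub mu mu (tdist_BLball set0))).
Qed.

Lemma MH_sym mu nu : MH mu nu = MH nu mu.
Proof. by rewrite /MH; under eq_imagel do rewrite distrC. Qed.

Lemma MH_triangle nu mu la : MH mu la <= MH mu nu + MH nu la.
Proof.
apply: MH_le => f f1; rewrite (le_trans (ler_distD (\int[nu]_y f y) _ _))//.
by rewrite lerD// MH_ub.
Qed.

Lemma MH_positivity mu nu : MH mu nu = 0 -> mu = nu.
Proof.
move=> munu0; apply: BL_separates_Q => f [k _ kf].
have k0 := BLball_ge0 point kf.
have k1 : 0 < k + 1 by lra.
have := MH_BLball mu nu k1 (BLballW _ kf); rewrite munu0 mulr0 => le0.
by apply/eqP; rewrite -subr_eq0 -normr_le0; apply: le0; rewrite lerDl.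
Qed.

End MH_metric.

(** * Completeness *)

Section tightness.
Context {R : realType} {Y : completeMetricType R}.

(** The open unions of the first [n] balls of radius [d] around a dense sequence
    increase to the whole space, so their mass tends to 1. *)
Lemma separable_tight (hY : separable Y) (nu : Q Y) e d : 0 < e -> 0 < d ->
  exists s : seq Y,
    \int[nu]_y tdist [set x | exists2 a, a \in s & ball a d x] y <= e.
Proof.
move=> e0 d0; have [S /countable_injP[h injh] dS] := hY.
pose D n : Y := xget point [set y | S y /\ h y = n].
have DS y : S y -> D (h y) = y.
  move=> Sy; rewrite /D; case: xgetP => [z _ [Sz hz]|/(_ y)].
    by apply: injh => //; rewrite inE.
  by case.
pose s n := [seq D i | i <- iota 0 n].
pose U n := [set x | exists2 a, a \in s n & ball a d x].
have mU n : measurable (U n : set (borel Y)).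
  apply: open_measurable_borel.
  have -> : U n = \bigcup_(a in [set` s n]) ball a d.
    by apply/seteqP; split=> x [a]; exists a.
  apply: bigcup_open => a _; rewrite ballEmdist openE => x/= ax.
  apply/nbhs_ballP; exists (d - mdist a x) => /=; first by rewrite subr_gt0.
  move=> y; rewrite ballEmdist/= => xy.
  by have := metric_triangle a x y; lra.
have ndU : {homo U : n m / (n <= m)%N >-> (n <= m)%O}.
  move=> n m nm; apply/subsetPset => x [a /mapP[i]].
  rewrite mem_iota add0n => /= ni -> ax; exists (D i) => //.
  by apply: map_f; rewrite mem_iota/= add0n (leq_trans ni).
have UT : \bigcup_n U n = setT.
  apply/seteqP; split=> // x _.
  have [||a [xa Sa]] := dS (ball x d)^°.
  - by exists x; exact: nbhsx_ballx.
  - exact: open_interior.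
  have {}xa := interior_subset xa.
  exists (h a).+1 => //; exists a; last exact: ball_sym.
  by apply/mapP; exists (h a); rewrite ?DS// mem_iota/= add0n.
have nuU : nu (U n) @[n --> \oo] --> 1%E.
  rewrite -(probability_setT nu) -UT; apply: nondecreasing_cvg_mu => //.
  by rewrite UT.
have [n nUn] : exists n, ((1 - e)%:E < nu (U n))%E.
  apply: contrapT => /forallNP nU.
  have : (limn (nu \o U) <= (1 - e)%:E)%E.
    apply: lime_le; first by apply/cvg_ex; exists 1%E.
    by apply: nearW => n; rewrite leNgt; exact/negP/nU.
  by rewrite (cvg_lim _ nuU)// lee_fin; lra.
exists (s n); rewrite -/(U n).
have mC : measurable (~` U n : set (borel Y)) by exact: measurableC.
apply: (@le_trans _ _ (\int[nu]_y (\1_(~` U n) : borel Y -> R) y)).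
  apply: le_Rintegral => //; first exact/BL_integrable/BL_tdist.
    exact: integrable_indic.
  move=> x _; rewrite indicE; have [_|xU] := boolP (x \in ~` U n).
    exact: tdist_le1.
  by rewrite tdist_eq0//; apply: contrapT => nUx; rewrite mem_set in xU.
rewrite /Rintegral integral_indic// setIT -lee_fin fineK ?fin_num_measure//.
rewrite /= probability_setC// -(fineK (fin_num_measure nu _ (mU n))).
rewrite -EFinB lee_fin.
by rewrite lerBlDr -lerBlDl ltW// -lte_fin fineK ?fin_num_measure.
Qed.

End tightness.

Section cauchy_limit.
Context {R : realType} {Y : completeMetricType R} (hY : separable Y).
Context (F : set_system (Q Y)) {FF : ProperFilter F}.
Context (cauchyF : forall e : R, 0 < e ->
  exists mu, F [set nu | MH mu nu < e]).

Definition limit_mean (f : Y -> R) : R :=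
  lim (\int[Qmeasure nu]_y f y @[nu --> F]).

Lemma BL_integral_cvg f : BL f ->
  \int[Qmeasure nu]_y f y @[nu --> F] --> limit_mean f.
Proof.
move=> [k _ kf]; have k0 := BLball_ge0 point kf.
have k1 : 0 < k + 1 by lra.
have {}kf : BLball (k + 1) f by apply: BLballW kf; rewrite lerDl.
suff : cvg (\int[Qmeasure nu]_y f y @[nu --> F]) by [].
apply: cauchy_cvg; apply: cauchy_exP => e e0.
have [mu muF] := cauchyF (divr_gt0 e0 k1).
exists (\int[mu]_y f y).
suff : F [set nu | `|\int[mu]_y f y - \int[Qmeasure nu]_y f y| < e] by [].
apply: filterS muF => nu /= munu.
rewrite (le_lt_trans (MH_BLball mu nu k1 kf))//.
by rewrite mulrC -ltr_pdivlMr.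
Qed.

(** The uniformity over Lipschitz balls is what allows tightness to pass to the
    limit, and what finally gives convergence for [MH]. *)
Lemma limit_mean_near (e : R) : 0 < e -> \forall nu \near F,
  forall k f, 0 < k -> BLball k f ->
    `|limit_mean f - \int[Qmeasure nu]_y f y| <= k * e.
Proof.
move=> e0; have [mu muF] := cauchyF (divr_gt0 e0 (ltr0Sn R 1)).
apply: filterS (muF) => nu /= munu k f k0 kf.
have bf : BL f by exists k.
apply/ler_addgt0Pr => d d0.
have /cvgrPdist_lt/(_ d d0) Fd := BL_integral_cvg bf.
have [la [laf mula]] := filter_ex (filterI Fd muF).
rewrite (le_trans (ler_distD (\int[la]_y f y) _ _))// addrC lerD//;
  last exact: ltW.
rewrite (le_trans (MH_BLball la nu k0 kf))// ler_pM2l//.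
have := MH_triangle mu la nu; rewrite (MH_sym la mu).
by move: munu mula => /=; lra.
Qed.

Lemma limit_meanE (f : Y -> R) (l : R) :
  \int[Qmeasure nu]_y f y @[nu --> F] --> l -> limit_mean f = l.
Proof. by move=> fl; apply/cvg_lim. Qed.

Lemma limit_mean_tight : tight_mean limit_mean.
Proof.
split.
- move=> f g bf bg; apply: limit_meanE.
  under eq_fun do rewrite BL_RintegralD//.
  exact: (cvgD (@BL_integral_cvg f bf) (@BL_integral_cvg g bg)).
- move=> c f bf; apply: limit_meanE.
  under eq_fun do rewrite BL_RintegralZ//.
  exact: (cvgM (cvg_cst c) (@BL_integral_cvg f bf)).
- move=> f g bf bg fg; rewrite -subr_ge0.
  have fgL : (\int[Qmeasure nu]_y g y - \int[Qmeasure nu]_y f y)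
      @[nu --> F] --> limit_mean g - limit_mean f.
    exact: (cvgB (@BL_integral_cvg g bg) (@BL_integral_cvg f bf)).
  apply: (cvgr_to_ge fgL); apply: nearW => nu.
  by rewrite subr_ge0; exact: BL_le_Rintegral.
- apply: limit_meanE.
  under eq_fun do rewrite probability_Rintegral_cst.
  exact: cvg_cst.
- move=> e d e0 d0; have e2 : 0 < e / 2 by rewrite divr_gt0.
  have [nu nuF] := filter_ex (limit_mean_near e2).
  have [s snu] := separable_tight hY nu e2 d0; exists s.
  have := nuF 1 _ ltr01
    (tdist_BLball [set x | exists2 a, a \in s & ball a d x]).
  by rewrite mul1r ler_norml => /andP[_]; lra.
Qed.

Lemma MH_cauchy_cvg :
  exists mu, forall e : R, 0 < e -> F [set nu | MH mu nu < e].
Proof.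
exists (mean_measure limit_mean_tight) => e e0.
have e2 : 0 < e / 2 by rewrite divr_gt0.
apply: filterS (limit_mean_near e2) => nu /= nuL.
apply: (@le_lt_trans _ _ (e / 2)); last by lra.
apply: MH_le => f f1; rewrite mean_Rintegral; last by exists 1.
by rewrite -[leRHS]mul1r; exact: nuL.
Qed.

End cauchy_limit.

(** Evaluation at [p] represents the Dirac mass, which provides the
    distinguished point that a complete space must have. *)
Lemma eval_tight_mean {R : realType} {Y : completeMetricType R} (p : Y) :
  tight_mean (fun f : Y -> R => f p).
Proof.
split => // e d e0 d0; exists [:: p].
rewrite tdist_eq0 ?ltW//=; exists p; rewrite ?mem_head//.
exact: ballxx.
Qed.

(** The proof of separability is carried by the type because the completeness
    of [Q Y], attached to it below, depends on it. *)
Definition MHspace (R : realType) (Y : completeMetricType R) of separable Y :=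
  Q Y.

Section MHspace.
Context {R : realType} {Y : completeMetricType R} (hY : separable Y).
Local Notation Z := (MHspace hY).

HB.instance Definition _ := gen_eqMixin Z.
HB.instance Definition _ := gen_choiceMixin Z.
HB.instance Definition _ :=
  isPointed.Build Z (mean_measure (eval_tight_mean (point : Y))).
HB.instance Definition _ := @isMetric.Build R Z (@MH R Y)
  (@MHxx R Y) (@MH_positivity R Y) (@MH_sym R Y) (@MH_triangle R Y).

Let MHspace_cauchy_cvg (F : set_system Z) : ProperFilter F -> cauchy F -> cvg F.
Proof.
move=> FF /cauchyP cF.
have [mu muF] : exists mu : Z, forall e, 0 < e -> F [set nu | MH mu nu < e].
  apply: (MH_cauchy_cvg hY) => e e0; have [mu] := cF e e0.
  by rewrite ballEmdist; exists mu.
apply/cvg_ex; exists mu => A /nbhs_ballP[e /= e0 muA].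
by apply: filterS (muF e e0) => nu munu; apply: muA; rewrite ballEmdist.
Qed.

HB.instance Definition _ := Uniform_isComplete.Build Z MHspace_cauchy_cvg.
End MHspace.

Theorem theorem2p11 (R : realType) (Y : completeMetricType R)
  (hY : separable Y) : is_complete_metric (@MH R Y).
Proof.
by exists (CompleteMetric.class (MHspace hY)).
Qed.
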